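(* Let $(X,\mathcal A,\mu)$ be a normalized finitely additive measure space. Suppose that for every $P\in\mathcal A$ which occurs as a part of a partition of $X$, a non-empty family $\mathcal F_P$ of measurable functions $f:P\to\mathbb C$ with $\|f\|_\infty\le 1$ is fixed. Suppose that for every positive integer $M$ a class $\mathsf{Part}_M(X)$ of (admissible) partitions of $X$ with at most $M$ parts is fixed. Suppose further that a refinement scheme $(\Phi,\psi)$ is given for which the chosen witnesses become measurable with respect to the refinement; that is, $\Phi:\mathbb N\to\mathbb N$ is a function and $\psi$ assigns to every partition $\mathcal P\in\mathsf{Part}_M(X)$ ($M$ a positive integer) and every family of witnesses $\{f_P\}_{P\in\mathcal P}$ with $f_P\in\mathcal F_P$ for each $P\in\mathcal P$ a partition $\mathcal P'=\psi(\mathcal P,\{f_P\}_{P\in\mathcal P})\in\mathsf{Part}_{\Phi(M)}(X)$ which refines $\mathcal P$ and is such that, for each $P\in\mathcal P$, the function $f_P$ is constant on every part of $\mathcal P'|_P$. Let $g:X\to[0,1]$ be an $\mathcal A$-measurable function, let $\varepsilon>0$, let $M_0$ be a positive integer, and let $\mathcal P_0\in\mathsf{Part}_{M_0}(X)$. Then there exist an integer $t$ with $0\le t\le\lceil\varepsilon^{-2}\rceil$ and a partition $\mathcal P_t\in\mathsf{Part}_{\Phi^{\circ t}(M_0)}(X)$ which is $\varepsilon$-regular for $g$ with respect to the families $(\mathcal F_P)_{P\in\mathcal P_t}$, where $\Phi^{\circ t}$ denotes the $t$-fold composition of $\Phi$ with itself.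
   Context: A normalized finitely additive measure space $(X,\mathcal A,\mu)$ consists of a set $X$, an algebra $\mathcal A$ of subsets of $X$ (not necessarily a $\sigma$-algebra), and a finitely additive function $\mu:\mathcal A\to[0,1]$ with $\mu(X)=1$. Integrals of bounded $\mathcal A$-measurable functions with respect to $\mu$ are the usual ones for finitely additive measures (defined on simple functions and extended by uniform limits). For $P\in\mathcal A$ with $\mu(P)>0$ and a bounded measurable function $h$ (on $X$ or on $P$), $\mathbb E_P[h]=\frac1{\mu(P)}\int_P h\,d\mu$. A partition of $X$ always means a finite collection $\{P_1,\dots,P_n\}\subset\mathcal A$ of disjoint sets with $\bigcup_i P_i=X$ and $\mu(P_i)>0$ for all $i$. A partition $\mathcal Q$ refines a partition $\mathcal P$ if every $Q\in\mathcal Q$ is contained in some $P\in\mathcal P$. For $P\in\mathcal P$, $\mathcal Q|_P=\{Q\in\mathcal Q: Q\subseteq P\}$. Regularity: given an $\mathcal A$-measurable $g:X\to[0,1]$, a partition $\mathcal P$ is $\varepsilon$-regular for $g$ with respect to the families $(\mathcal F_P)_{P\in\mathcal P}$ if $$\sum_{P\in\mathcal P}\mu(P)\sup_{f\in\mathcal F_P}\left|\mathbb E_P\left[(g|_P-\mathbb E_P[g|_P])\cdot f\right]\right|\le\varepsilon,$$ where $g|_P$ is the restriction of $g$ to $P$. Here $\Phi^{\circ 0}$ is the identity. *)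

(* Defs.v *)
From HB Require Import structures.
From mathcomp Require Import all_boot all_order all_algebra.
From mathcomp Require Import finmap complex.
From mathcomp Require Import all_classical all_reals all_analysis.

Set Implicit Arguments.
Unset Strict Implicit.
Unset Printing Implicit Defensive.

Import Order.TTheory GRing.Theory Num.Theory numFieldNormedType.Exports.

Local Open Scope classical_set_scope.
Local Open Scope ring_scope.
Local Open Scope complex_scope.

(* A function on a set [D] is represented by a total function on the ambient  *)
(* type of which only the values on [D] are used.                             *)

Section measurability.
Context d (X : algebraOfSetsType d) (R : realType).
Implicit Types (D : set X).

Definition simple_on D (s : X -> R) : Prop :=
  finite_set (s @` D) /\ forall r, measurable (D `&` s @^-1` [set r]).

(* Bounded measurability relative to an algebra: uniform limits of simple     *)
(* functions. Every bounded function for which the preimages of intervals lie *)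
(* in the algebra is of this kind; since the algebra need not be a            *)
(* sigma-algebra, preimage measurability is not stable under products, while  *)
(* this class is stable and is exactly the domain of the integral.            *)
Definition bounded_measurable_on D (h : X -> R) : Prop :=
  exists s : nat -> X -> R,
    (forall n, simple_on D (s n)) /\ {uniform D, s @ \oo --> h}.

Definition bounded_measurable_onC D (f : X -> R[i]) : Prop :=
  bounded_measurable_on D (fun x => complex.Re (f x)) /\
  bounded_measurable_on D (fun x => complex.Im (f x)).

End measurability.

Section integration.
Context d (X : algebraOfSetsType d) (R : realType).
Variable mu : {content set X -> \bar R}.
Implicit Types (P : set X) (h : X -> R) (f : X -> R[i]).

Definition simple_integral P (s : X -> R) : R :=
  \sum_(r \in s @` P) r * fine (mu (P `&` s @^-1` [set r])).

(* The default value 0 is only taken when [h] is not bounded measurable.      *)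
Definition fa_integral P h : R :=
  xget 0 [set I | exists s : nat -> X -> R,
    [/\ forall n, simple_on P (s n),
        {uniform P, s @ \oo --> h} &
        simple_integral P (s n) @[n --> \oo] --> I]].

Definition fa_integralC P f : R[i] :=
  fa_integral P (fun x => complex.Re (f x)) +i*
  fa_integral P (fun x => complex.Im (f x)).

Definition expect P h : R := (fine (mu P))^-1 * fa_integral P h.

Definition expectC P f : R[i] := ((fine (mu P))^-1)%:C * fa_integralC P f.

End integration.

Section partitions.
Context d (X : algebraOfSetsType d) (R : realType).
Variable mu : {content set X -> \bar R}.
Implicit Types (PP QQ : {fset set X}) (P Q : set X).
Implicit Types (F : set X -> set (X -> R[i])) (w : set X -> X -> R[i]).

Definition is_partition PP : Prop :=
  [/\ forall P, P \in PP -> measurable P,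
      trivIset [set` PP] id,
      cover [set` PP] id = [set: X] &
      forall P, P \in PP -> (0 < mu P)%E].

Definition occurs_in_partition P : Prop :=
  exists2 PP, is_partition PP & P \in PP.

Definition refines QQ PP : Prop :=
  forall Q, Q \in QQ -> exists2 P, P \in PP & Q `<=` P.

Definition witness_class F : Prop :=
  forall P, occurs_in_partition P ->
    F P !=set0 /\
    forall f, F P f ->
      bounded_measurable_onC P f /\ forall x, P x -> Normc.normc (f x) <= 1.

(* [Part M] is only meaningful for [0 < M]; the size bound makes [Part 0]     *)
(* empty as soon as [mu setT = 1].                                            *)
Definition admissible_partitions (Part : nat -> set {fset set X}) : Prop :=
  forall M PP, Part M PP -> is_partition PP /\ (#|` PP| <= M)%N.

(* A family of witnesses indexed by the parts of [PP] is represented by a     *)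
(* family indexed by all sets, constrained only at the parts of [PP].         *)
Definition refinement_scheme F (Part : nat -> set {fset set X})
    (Phi : nat -> nat)
    (psi : {fset set X} -> (set X -> X -> R[i]) -> {fset set X}) : Prop :=
  forall M PP w, (0 < M)%N -> Part M PP -> (forall P, P \in PP -> F P (w P)) ->
    [/\ Part (Phi M) (psi PP w),
        refines (psi PP w) PP &
        forall P Q, P \in PP -> Q \in psi PP w -> Q `<=` P ->
          forall x y, Q x -> Q y -> w P x = w P y].

Definition eps_regular F (g : X -> R) (eps : R) PP : Prop :=
  (\sum_(P <- PP)
     mu P * ereal_sup
       [set (Normc.normc
               (expectC mu P (fun x => (g x - expect mu P g)%:C * f x)))%:E
       | f in F P] <= eps%:E)%E.

End partitions.

(* Main.v *)
(* Energy increment. The energy of a partition is the sum over its parts P of *)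
(* mu(P) E_P[g]^2 and lies in [0, 1]. If a partition is not eps-regular,      *)
(* choose witnesses f_P of irregularity and pass to the refinement given by   *)
(* the scheme. As f_P is constant on the new parts, the correlation of        *)
(* g - E_P[g] with f_P is at most the mean of |E_Q[g] - E_P[g]| over the new  *)
(* parts Q of P, so by Cauchy-Schwarz and orthogonality the energy grows by   *)
(* more than eps^2. This cannot happen more than eps^-2 times.                *)

Require Import Defs.
From HB Require Import structures.
From mathcomp Require Import all_boot all_order all_algebra.
From mathcomp Require Import finmap complex zify ring lra.
From mathcomp Require Import all_classical all_reals all_analysis.

Set Implicit Arguments.
Unset Strict Implicit.
Unset Printing Implicit Defensive.

Import Order.TTheory GRing.Theory Num.Theory numFieldNormedType.Exports.

Local Open Scope classical_set_scope.
Local Open Scope ring_scope.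

(** Write G_P for the integral of g over P. The energy, the sum of G_P^2 / mu(P), is at most 1
    because |g| <= 1 ([energy_le1]), so it suffices to refine any irregular partition with an energy
    gain above eps^2.

    If f_P is constant on the new parts Q of P, its correlation with g - E_P[g] sees only the
    deviations y_Q = G_Q - E_P[g] mu(Q), and the sum of y_Q^2 / mu(Q) is exactly the energy gained
    on P. Cauchy-Schwarz enters in the linearized form 2 eps |y_Q| <= y_Q^2 / mu(Q) + eps^2 mu(Q),
    which can be summed part by part ([energy_gain_part], [energy_increment]). A total correlation
    above eps thus forces a gain above 2 eps^2 - eps^2.

    The suprema in the definition of regularity need not be attained; [sum_ereal_sup_le] reduces a
    bound on their weighted sum to the same bound for all choices of witnesses. The analytic basis
    is that the integral does not depend on the approximating simple functions ([fa_integral_cvg])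
    and can be computed part by part against a function constant on the parts
    ([fa_integral_parts]). *)

Lemma normc_Re_le (R : rcfType) (z : R[i]) : `|complex.Re z| <= Normc.normc z.
Proof. by case: z => a b /=; rewrite -sqrtr_sqr ler_wsqrtr// lerDl sqr_ge0. Qed.

Lemma normc_Im_le (R : rcfType) (z : R[i]) : `|complex.Im z| <= Normc.normc z.
Proof. by case: z => a b /=; rewrite -sqrtr_sqr ler_wsqrtr// lerDr sqr_ge0. Qed.

Lemma normc_real (R : rcfType) (a : R) : Normc.normc a%:C%C = `|a|.
Proof. by rewrite /= expr0n addr0 sqrtr_sqr. Qed.

Lemma normc_sum_le (R : rcfType) (I : Type) (r : seq I) (f : I -> R[i]) :
  Normc.normc (\sum_(i <- r) f i) <= \sum_(i <- r) Normc.normc (f i).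
Proof.
elim: r => [|i r IH]; first by rewrite !big_nil Normc.normc0.
by rewrite !big_cons (le_trans (le_normcD _ _))// lerD2l.
Qed.

Lemma complex_sum (R : rcfType) (I : Type) (r : seq I) (a : I -> R)
    (c : I -> R[i]) :
  \sum_(i <- r) (a i)%:C%C * c i =
  ((\sum_(i <- r) complex.Re (c i) * a i) +i*
   (\sum_(i <- r) complex.Im (c i) * a i))%C.
Proof.
elim: r => [|i r IH]; first by rewrite !big_nil.
by rewrite !big_cons IH; case: (c i) => u v; simpc; rewrite ![a i * _]mulrC.
Qed.

Lemma cvg_uniform_onP (T : choiceType) (R : realType) (D : set T)
    (s : nat -> T -> R) (h : T -> R) :
  {uniform D, s @ \oo --> h} <->
  (forall e, 0 < e ->
     \forall n \near \oo, forall x, D x -> `|h x - s n x| < e).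
Proof.
split=> [sh e e0|sh].
  apply: (sh [set f | forall x, D x -> `|h x - f x| < e]).
  apply/uniform_nbhs; exists [set xy | `|xy.1 - xy.2| < e].
  by split => //; apply: entourage_ball (PosNum e0).
move=> V /uniform_nbhs [E []]; rewrite -entourage_ballE => -[e /= e0 eE] EV.
by apply: filterS (sh e e0) => n sn; apply: EV => y Dy; apply: eE; exact: sn.
Qed.

(** * The integral of bounded measurable functions for a finitely additive measure *)

Section content.
Context d (X : algebraOfSetsType d) (R : realType).
Variable mu : {content set X -> \bar R}.
Hypothesis mu1 : mu [set: X] = 1%E.
Local Notation m A := (fine (mu A)).
Implicit Types (A P : set X) (s t : X -> R).

Lemma content_fin_num A : measurable A -> mu A \is a fin_num.
Proof.
move=> mA; rewrite ge0_fin_numE//; apply: (@le_lt_trans _ _ (mu setT)).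
  by apply: le_measure; rewrite ?inE.
by rewrite mu1 ltry.
Qed.

Lemma fine_content_bigcup (I : choiceType) (D : set I) (A : I -> set X) :
  finite_set D -> trivIset D A -> (forall i, D i -> measurable (A i)) ->
  m (\bigcup_(i in D) A i) = \sum_(i \in D) m (A i).
Proof.
move=> fD tA mA; rewrite measure_fin_bigcup// !fsbig_finite//=.
rewrite big_seq [RHS]big_seq sum_fine// => i.
by rewrite in_fset_set// inE => Di; apply: content_fin_num; exact: mA.
Qed.

Lemma simple_on_subset A P s : measurable A -> A `<=` P ->
  simple_on P s -> simple_on A s.
Proof.
move=> mA AP [fs ms]; split.
  by apply: sub_finite_set fs => _ [x Ax <-]; exists x => //; exact: AP.
move=> r; have -> : A `&` s @^-1` [set r] = A `&` (P `&` s @^-1` [set r]).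
  by rewrite setIA (setIidl AP).
exact: measurableI.
Qed.

Lemma content_split_simple A P s : measurable A -> A `<=` P -> simple_on P s ->
  m A = \sum_(r \in s @` P) m (A `&` s @^-1` [set r]).
Proof.
move=> mA AP [fs ms]; rewrite -fine_content_bigcup//.
- congr (fine (mu _)); rewrite seteqP; split=> [x Ax|x [r _ []]//].
  by exists (s x) => //; exists x => //; exact: AP.
- by move=> i j _ _ [x [[_ /= <-] [_ /= <-]]].
- move=> r _; have -> : A `&` s @^-1` [set r] = A `&` (P `&` s @^-1` [set r]).
    by rewrite setIA (setIidl AP).
  exact: measurableI.
Qed.

(** Passing to the joint level sets of [s] and [t] lets the integrals of two simple functions be
    compared term by term. *)
Lemma simple_integral_refine P s t : simple_on P s -> simple_on P t ->
  simple_integral mu P s = \sum_(a \in s @` P) \sum_(b \in t @` P)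
    a * m (P `&` s @^-1` [set a] `&` t @^-1` [set b]).
Proof.
move=> ss st; rewrite /simple_integral; apply: eq_fsbigr => a _.
rewrite -mulr_fsumr; congr (_ * _); apply: content_split_simple => //.
by have [_] := ss; exact.
Qed.

Lemma simple_integral_comp P s t (phi : R -> R) : measurable P ->
  simple_on P s -> (forall x, P x -> t x = phi (s x)) ->
  simple_on P t /\
  simple_integral mu P t =
    \sum_(a \in s @` P) phi a * m (P `&` s @^-1` [set a]).
Proof.
move=> mP ss tE; have st : simple_on P t.
  case: ss => fs ms; split.
    apply: (@sub_finite_set _ _ (phi @` (s @` P))); last exact: finite_image.
    by move=> _ [x Px <-]; rewrite tE//; exists (s x) => //; exists x.
  move=> r; have -> : P `&` t @^-1` [set r] =
      \bigcup_(a in (s @` P) `&` phi @^-1` [set r]) (P `&` s @^-1` [set a]).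
    rewrite seteqP; split=> x /=.
      move=> [Px tx]; exists (s x) => //=; split; first by exists x.
      by rewrite -tE.
    by move=> [a [_ ar] [Px sa]]; split => //; rewrite tE// sa.
  by apply: fin_bigcup_measurable => //; exact: finite_setIl.
split => //; rewrite (simple_integral_refine st ss).
rewrite exchange_fsbig; [|by case: st|by case: ss].
apply: eq_fsbigr => a _.
rewrite [in RHS](@content_split_simple _ P t)//; first last.
  by case: ss.
rewrite mulr_fsumr; apply: eq_fsbigr => b _.
rewrite setIAC.
(* A joint level set is either empty, so both terms vanish, or contains a point, which forces
   [b = phi a]. *)
have [|/negP/negP] :=
  boolP (P `&` s @^-1` [set a] `&` t @^-1` [set b] == set0).
  by move=> /eqP ->; rewrite measure0 !mulr0.
by move=> /set0P [x [[Px /= <-] /= <-]]; rewrite tE.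
Qed.

Lemma simple_integral_affine P s t (c k : R) : measurable P ->
  simple_on P s -> (forall x, P x -> t x = c * (s x - k)) ->
  simple_on P t /\
  simple_integral mu P t = c * (simple_integral mu P s - k * m P).
Proof.
move=> mP ss tE.
have [st ->] := simple_integral_comp (phi := fun a => c * (a - k)) mP ss tE.
split=> //; rewrite /simple_integral.
rewrite (content_split_simple mP (@subset_refl _ P) ss).
rewrite mulrBr !mulr_fsumr; case: ss => fs _.
rewrite !(fsbig_finite _ _ fs)/= -sumrB; apply: eq_bigr => a _.
by rewrite mulrBr mulrBl !mulrA.
Qed.

Lemma simple_integral_dist P s t (e : R) : measurable P ->
  simple_on P s -> simple_on P t -> (forall x, P x -> `|s x - t x| <= e) ->
  `|simple_integral mu P s - simple_integral mu P t| <= e * m P.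
Proof.
move=> mP ss st ste; rewrite (simple_integral_refine ss st).
have [fs _] := ss; have [ft _] := st.
rewrite (simple_integral_refine st ss) [X in _ - X]exchange_fsbig//.
rewrite (content_split_simple mP (@subset_refl _ P) ss).
rewrite !(fsbig_finite _ _ fs)/= -sumrB mulr_sumr.
apply: le_trans (ler_norm_sum _ _ _) _; apply: ler_sum => a _.
rewrite (@content_split_simple _ P t)//; last by have [_] := ss; exact.
rewrite !(fsbig_finite _ _ ft)/= -sumrB mulr_sumr.
apply: le_trans (ler_norm_sum _ _ _) _; apply: ler_sum => b _.
rewrite [in X in _ - X]setIAC -mulrBl normrM.
rewrite (ger0_norm (fine_ge0 _))//.
have [|/negP/negP] := boolP (P `&` s @^-1` [set a] `&` t @^-1` [set b] == set0).
  by move=> /eqP ->; rewrite measure0 !mulr0.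
move=> /set0P [x [[Px /= <-] /= <-]]; apply: ler_wpM2r; last exact: ste.
exact: fine_ge0.
Qed.

Lemma fine_content_le1 A : measurable A -> m A <= 1.
Proof.
move=> mA; rewrite -[leRHS](_ : fine (mu setT) = 1); last by rewrite mu1.
by apply: fine_le; rewrite ?content_fin_num//; apply: le_measure; rewrite ?inE.
Qed.

(** Both [s0] and, eventually, [s n] are within [e / 2] of [h], and [P] has measure at most 1. This
    serves twice below: for the Cauchy property and for independence of the approximating
    sequence. *)
Lemma near_simple_integral_dist P s0 (h : X -> R) (s : nat -> X -> R) e :
  measurable P ->
  (forall n, simple_on P (s n)) -> {uniform P, s @ \oo --> h} -> 0 < e ->
  simple_on P s0 -> (forall x, P x -> `|h x - s0 x| < e / 2) ->
  \forall n \near \oo,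
    `|simple_integral mu P s0 - simple_integral mu P (s n)| <= e.
Proof.
move=> mP ss /cvg_uniform_onP sh e0 ss0 s0h.
apply: filterS (sh _ (divr_gt0 e0 (ltr0Sn _ 1))) => n sn.
apply: (@le_trans _ _ (e * m P)); last first.
  by apply: ler_piMr; [exact: ltW|exact: fine_content_le1].
apply: simple_integral_dist => // x Px; rewrite -(subrKA (h x)) [e]splitr.
apply: (le_trans (ler_normD _ _)); apply: lerD; last exact/ltW/sn.
by rewrite distrC ltW// s0h.
Qed.

(** Existence of the limit makes [xget] return the limit along some sequence [s']; a far term of
    [s'] serves as the reference function that ties the integrals of [s] to the same limit. *)
Lemma fa_integral_cvg P (h : X -> R) (s : nat -> X -> R) : measurable P ->
  (forall n, simple_on P (s n)) -> {uniform P, s @ \oo --> h} ->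
  simple_integral mu P (s n) @[n --> \oo] --> fa_integral mu P h.
Proof.
move=> mP ss sh; pose I := fa_integral mu P h.
have : exists I : R, exists s : nat -> X -> R, [/\ forall n, simple_on P (s n),
    {uniform P, s @ \oo --> h} & simple_integral mu P (s n) @[n --> \oo] --> I].
  suff /cauchy_cvgP cvs : cauchy (simple_integral mu P (s n) @[n --> \oo]).
    by exists (lim (simple_integral mu P (s n) @[n --> \oo])), s.
  apply: cauchy_exP => e e0; have e20 : 0 < e / 2 by rewrite divr_gt0.
  have [N _ /(_ N (leqnn N)) sN] :=
    (cvg_uniform_onP P s h).1 sh (e / 2 / 2) (divr_gt0 e20 (ltr0Sn _ 1)).
  exists (simple_integral mu P (s N)).
  apply: filterS (near_simple_integral_dist mP ss sh e20 (ss N) sN) => n.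
  by move=> /le_lt_trans; apply; rewrite ltr_pdivrMr// mulrDr mulr1 ltrDl.
move=> /(xgetPex 0) [s' [ss' s'h]]; rewrite -/(fa_integral mu P h) -/I => s'I.
apply/cvgrPdist_le => e e0; have e20 : 0 < e / 2 by rewrite divr_gt0.
have [N _ NP] : \forall n \near \oo,
    `|I - simple_integral mu P (s' n)| <= e / 2 /\
    forall x, P x -> `|h x - s' n x| < e / 2 / 2.
  apply: filterI; first by move/cvgrPdist_le: s'I; exact.
  by apply: (cvg_uniform_onP P s' h).1 => //; rewrite divr_gt0.
have [/= IN s'N] := NP N (leqnn N).
apply: filterS (near_simple_integral_dist mP ss sh e20 (ss' N) s'N) => n sn.
rewrite -(subrKA (simple_integral mu P (s' N))) [e]splitr.
by apply: (le_trans (ler_normD _ _)); exact: lerD.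
Qed.

Lemma fa_integral_norm_le P (h : X -> R) :
  measurable P -> bounded_measurable_on P h ->
  (forall x, P x -> `|h x| <= 1) -> `|fa_integral mu P h| <= m P.
Proof.
move=> mP [s [ss sh]] h1; apply/ler_addgt0Pr => e e0.
have e20 : 0 < e / 2 by rewrite divr_gt0.
have /cvgrPdist_le/(_ _ e20) := fa_integral_cvg mP ss sh.
move/filterI => /(_ _ ((cvg_uniform_onP P s h).1 sh _ e20))[N _].
move=> /(_ N (leqnn N)) /= [IN hN].
rewrite -[fa_integral _ _ _](subrK (simple_integral mu P (s N))).
apply: (le_trans (ler_normD _ _)); rewrite addrC [e]splitr addrA lerD//.
(* The zero function is seen as an affine image of [s N], so that the bound on the integral of [s N]
   becomes a distance to 0. *)
have [s0 I0] := simple_integral_affine (t := cst 0) (c := 0) (k := 0) mP (ss N)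
  (fun x _ => esym (mul0r _)).
rewrite -[simple_integral _ _ _]subr0.
rewrite -[X in _ - X](mul0r (simple_integral mu P (s N) - 0 * m P)).
rewrite -I0; apply: (@le_trans _ _ ((1 + e / 2) * m P)).
  apply: simple_integral_dist => // x Px; rewrite subr0 -[s N x](subKr (h x)).
  apply: (le_trans (ler_normB _ _)); rewrite lerD ?h1//; exact/ltW/hN.
rewrite mulrDl mul1r lerD2l.
by apply: ler_piMr; [exact: ltW|exact: fine_content_le1].
Qed.

(** * Integrals over a set cut into finitely many parts, and the energy gain there *)

Section finite_partition.
Variables (P : set X) (r : seq (set X)).
Hypotheses (ur : uniq r) (mr : forall Q, Q \in r -> measurable Q)
  (tr : trivIset [set` r] id) (Pr : P = \bigcup_(Q in [set` r]) Q).

Let fr : finite_set [set` r]. Proof. exact: finite_seq. Qed.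

Lemma measurable_of_parts : measurable P.
Proof. by rewrite Pr; apply: fin_bigcup_measurable. Qed.

Lemma fine_content_parts : m P = \sum_(Q <- r) m Q.
Proof. by rewrite Pr fine_content_bigcup// [RHS]fsbig_seq. Qed.

Lemma simple_integral_parts s : (forall Q, Q \in r -> simple_on Q s) ->
  simple_on P s /\
  simple_integral mu P s = \sum_(Q <- r) simple_integral mu Q s.
Proof.
move=> ss; have fs : finite_set (s @` P).
  rewrite Pr image_bigcup; apply: bigcup_finite => // Q Qr.
  by case: (ss Q Qr).
have PE a : P `&` s @^-1` [set a] =
    \bigcup_(Q in [set` r]) (Q `&` s @^-1` [set a]).
  by rewrite Pr setI_bigcupl.
have mQ a Q : [set` r] Q -> measurable (Q `&` s @^-1` [set a]).
  by move=> Qr; have [_] := ss Q Qr; exact.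
split.
  by split=> // a; rewrite PE; exact: fin_bigcup_measurable fr (mQ a).
rewrite [RHS]fsbig_seq// /simple_integral.
transitivity (\sum_(a \in s @` P) \sum_(Q \in [set` r])
    a * m (Q `&` s @^-1` [set a])).
  apply: eq_fsbigr => a _; rewrite PE fine_content_bigcup//.
  - by rewrite mulr_fsumr.
  - by move=> Q Q' Qr Q'r [x [[Qx _] [Q'x _]]]; apply: tr => //; exists x.
  - exact: mQ.
(* The values that [s] takes on [P] but not on [Q] contribute empty level sets, so the range of
   summation may shrink to the image of [Q]. *)
rewrite exchange_fsbig//; apply: eq_fsbigr => Q; rewrite inE => Qr.
apply/esym/fsbig_widen.
  by apply: image_subset; rewrite Pr; exact: bigcup_sup.
move=> a [_ Qa] /=; rewrite (_ : _ `&` _ = set0) ?measure0 ?mulr0//.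
by rewrite -subset0 => x [Qx /= sx]; apply: Qa; exists x.
Qed.

(** If [s n] approximates [g], then [(s n - a) * phi] is an affine function of [s n] on each part,
    hence simple, and it converges uniformly because [phi] is bounded by 1. The formula for simple
    functions then passes to the limit. *)
Lemma fa_integral_parts g (c : set X -> R) (a : R) (phi : X -> R) :
  bounded_measurable_on P g ->
  (forall x, P x -> `|phi x| <= 1) ->
  (forall Q x, Q \in r -> Q x -> phi x = c Q) ->
  fa_integral mu P (fun x => (g x - a) * phi x) =
    \sum_(Q <- r) c Q * (fa_integral mu Q g - a * m Q).
Proof.
move=> [s [ss sg]] phi1 phiE; have mP := measurable_of_parts.
have QP Q : Q \in r -> Q `<=` P by move=> Qr; rewrite Pr; exact: bigcup_sup.
have ssQ n Q (Qr : Q \in r) : simple_on Q (s n).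
  exact: simple_on_subset (mr Qr) (QP _ Qr) (ss n).
pose t n x := (s n x - a) * phi x.
have tQ n Q (Qr : Q \in r) : simple_on Q (t n) /\ simple_integral mu Q (t n) =
    c Q * (simple_integral mu Q (s n) - a * m Q).
  apply: simple_integral_affine => //; [exact: mr|exact: ssQ|].
  by move=> x Qx; rewrite /t (phiE _ _ Qr Qx) mulrC.
have tP n := simple_integral_parts (fun Q Qr => (tQ n Q Qr).1).
have tg : {uniform P, t @ \oo --> (fun x => (g x - a) * phi x)}.
  apply/cvg_uniform_onP => e e0.
  apply: filterS ((cvg_uniform_onP P s g).1 sg e e0) => n sn x Px.
  rewrite /t -mulrBl normrM opprB addrA subrK; apply: le_lt_trans (sn x Px).
  by rewrite ler_piMr// phi1.
apply: (@cvg_unique _ (@Rhausdorff R)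
  (simple_integral mu P (t n) @[n --> \oo])).
  by apply: fa_integral_cvg => // n; case: (tP n).
have -> : (fun n => simple_integral mu P (t n)) =
    (fun n => \sum_(Q <- r | Q \in r)
      c Q * (simple_integral mu Q (s n) - a * m Q)).
  apply/funext => n; rewrite (tP n).2 big_seq; apply: eq_bigr => Q Qr.
  exact: (tQ n Q Qr).2.
rewrite big_seq; apply: cvg_big => [|Q Qr]; first exact: add_continuous.
apply: cvgMr; apply: cvgB; last exact: cvg_cst.
apply: fa_integral_cvg; [exact: mr|by move=> n; exact: ssQ|].
apply/cvg_uniform_onP => e e0.
apply: filterS ((cvg_uniform_onP P s g).1 sg e e0) => n sn x Qx.
by apply: sn; exact: QP Qx.
Qed.

Lemma fa_integral_sum_parts g : bounded_measurable_on P g ->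
  fa_integral mu P g = \sum_(Q <- r) fa_integral mu Q g.
Proof.
move=> bg; transitivity (fa_integral mu P (fun x => (g x - 0) * 1)).
  by congr (fa_integral _ _ _); apply/funext => x; rewrite subr0 mulr1.
rewrite (fa_integral_parts (c := cst 1) 0 (phi := cst 1) bg)//; last first.
  by move=> x _; rewrite normr1.
by apply: eq_bigr => Q _; rewrite mul1r mul0r subr0.
Qed.

Lemma expectC_parts g (f : X -> R[i]) (c : set X -> R[i]) (a : R) :
  bounded_measurable_on P g ->
  (forall x, P x -> Normc.normc (f x) <= 1) ->
  (forall Q x, Q \in r -> Q x -> f x = c Q) ->
  expectC mu P (fun x => (g x - a)%:C%C * f x) =
    ((m P)^-1)%:C%C *
    \sum_(Q <- r) (fa_integral mu Q g - a * m Q)%:C%C * c Q.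
Proof.
move=> bg f1 fc; rewrite complex_sum /expectC /fa_integralC.
rewrite -(fa_integral_parts (phi := fun x => complex.Re (f x)) a bg); first last.
- by move=> Q x Qr Qx; rewrite (fc Q).
- by move=> x Px; apply: le_trans (normc_Re_le _) (f1 x Px).
rewrite -(fa_integral_parts (phi := fun x => complex.Im (f x)) a bg); first last.
- by move=> Q x Qr Qx; rewrite (fc Q).
- by move=> x Px; apply: le_trans (normc_Im_le _) (f1 x Px).
congr (_ * _); apply/eqP; rewrite eq_complex; apply/andP.
split; apply/eqP; congr (fa_integral _ _ _); apply/funext => x;
  by case: (f x) => u v; simpc.
Qed.

(* The sum of the squares of the deviations of the averages over the parts    *)
(* from the average over [P] is the energy gain on [P]; AM-GM bounds the      *)
(* absolute deviations by it.                                                 *)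
Lemma energy_gain_part g (f : X -> R[i]) (eps : R) : 0 <= eps -> 0 < m P ->
  (forall Q, Q \in r -> 0 < m Q) ->
  bounded_measurable_on P g ->
  (forall x, P x -> Normc.normc (f x) <= 1) ->
  (forall Q x y, Q \in r -> Q x -> Q y -> f x = f y) ->
  2 * eps * (m P * Normc.normc
    (expectC mu P (fun x => (g x - expect mu P g)%:C%C * f x))) <=
  \sum_(Q <- r) fa_integral mu Q g ^+ 2 / m Q - fa_integral mu P g ^+ 2 / m P
    + eps ^+ 2 * m P.
Proof.
move=> eps0 mP0 mQ0 bg f1 fr_const.
(* The constant value of [f] on [Q]. The default is not taken on the parts in [r]: they have
   positive measure, hence are non-empty. *)
pose c (Q : set X) : R[i] := xget 0 (f @` Q).
have fc Q x : Q \in r -> Q x -> f x = c Q.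
  move=> Qr Qx; have [y Qy <-] : (f @` Q) (c Q).
    by apply: xgetPex; exists (f x), x.
  exact: fr_const Qr Qx Qy.
have c1 Q : Q \in r -> Normc.normc (c Q) <= 1.
  move=> Qr; have [Q0|/set0P[x Qx]] := eqVneq Q set0.
    by have := mQ0 Q Qr; rewrite Q0 measure0 ltxx.
  by rewrite -(fc Q x)// f1// Pr; exists Q.
rewrite (expectC_parts (expect mu P g) bg f1 fc) Normc.normcM normc_real.
rewrite ger0_norm ?invr_ge0 ?(ltW mP0)// mulVKf ?gt_eqF//.
set e := expect mu P g; set y := fun Q => fa_integral mu Q g - e * m Q.
apply: (@le_trans _ _ (2 * eps * \sum_(Q <- r) `|y Q|)).
  apply: ler_wpM2l; first by rewrite mulr_ge0.
  apply: (le_trans (normc_sum_le _ _)); rewrite big_seq [leRHS]big_seq.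
  apply: ler_sum => Q Qr; rewrite Normc.normcM normc_real ler_piMr//.
  exact: c1.
apply: (@le_trans _ _ (\sum_(Q <- r) (y Q ^+ 2 / m Q + eps ^+ 2 * m Q))).
  rewrite mulr_sumr big_seq [leRHS]big_seq; apply: ler_sum => Q /mQ0 Q0.
  rewrite -subr_ge0 (_ : _ - _ = (`|y Q| - eps * m Q) ^+ 2 / m Q).
    by rewrite divr_ge0 ?sqr_ge0 ?ltW.
  rewrite -[y Q ^+ 2]real_normK ?num_real//; field.
  by rewrite gt_eqF.
rewrite big_split /= -mulr_sumr -fine_content_parts lerD2r.
(* Orthogonality: after expansion, the integrals over the parts add up to [e * m P], so the last two
   terms together give [- e ^+ 2 * m P], which is minus the energy of [P]. *)
have -> : \sum_(Q <- r) y Q ^+ 2 / m Q = \sum_(Q <- r)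
    (fa_integral mu Q g ^+ 2 / m Q - 2 * e * fa_integral mu Q g + e ^+ 2 * m Q).
  apply: eq_big_seq => Q /mQ0 Q0; rewrite /y; field.
  by rewrite gt_eqF.
rewrite big_split /= sumrB -!mulr_sumr -fine_content_parts.
rewrite -fa_integral_sum_parts// /e /expect le_eqVlt; apply/orP; left; apply/eqP.
field; by rewrite gt_eqF.
Qed.

End finite_partition.

End content.
(** The choices at different indices are independent, so the suprema can be taken one index at a
    time. The constant [c] makes the induction work: it absorbs the term of the head once its
    witness is fixed. *)
Lemma sum_ereal_sup_le (R : realType) (I : eqType) (U : Type) (u0 : U)
    (r : seq I) (a : I -> R) (N : I -> U -> R) (F : I -> set U) (c e : R) :
  uniq r -> (forall i, i \in r -> 0 < a i) -> (forall i u, 0 <= N i u) ->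
  (forall i, i \in r -> F i !=set0) ->
  (forall w : I -> U, (forall i, i \in r -> F i (w i)) ->
     c + \sum_(i <- r) a i * N i (w i) <= e) ->
  (c%:E + \sum_(i <- r) (a i)%:E * ereal_sup [set (N i u)%:E | u in F i]
    <= e%:E)%E.
Proof.
move=> + + N0; elim: r c => [|i r IH] c /=.
  by move=> _ _ _ /(_ (fun=> u0)); rewrite !big_nil adde0 addr0 lee_fin; exact.
move=> /andP[ir ur] a0 F0 H; rewrite big_cons.
set S := (\sum_(j <- r) _)%E.
have a0r j : j \in r -> 0 < a j by move=> jr; rewrite a0// inE jr orbT.
have F0r j : j \in r -> F j !=set0 by move=> jr; apply: F0; rewrite inE jr orbT.
have HS u : F i u -> ((c + a i * N i u)%:E + S <= e%:E)%E.
  move=> Fu; apply: IH => // w Fw.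
  have := H (fun j => if j == i then u else w j); rewrite big_cons eqxx addrA.
  rewrite (eq_big_seq (fun j => a j * N j (w j))); last first.
    by move=> j jr; case: eqP => // ji; rewrite -ji jr in ir.
  apply=> j; rewrite inE => /predU1P[->|jr]; first by rewrite eqxx.
  by case: eqP => [->//|_]; exact: Fw.
have [u Fu] := F0 i (mem_head _ _).
have S0 : (0 <= S)%E.
  rewrite /S big_seq; apply: sume_ge0 => j jr.
  apply: mule_ge0; first by rewrite lee_fin ltW// a0r.
  have [v Fv] := F0r j jr; apply: (@le_trans _ _ (N j v)%:E).
    by rewrite lee_fin.
  by apply: ereal_sup_ubound; exists v.
(* The tail is finite: it is non-negative, and one witness at the head already bounds it above. *)
case: S S0 HS => [s| |]// S0 HS; last by have := HS u Fu.
have ai0 : 0 < a i by rewrite a0// mem_head.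
(* The number [(e - c - s) / a i] is the bound that [HS] gives for [N i v], uniformly in the witness
   [v]. *)
apply: (@le_trans _ _ (c%:E + ((a i)%:E * ((e - c - s) / a i)%:E + s%:E))%E).
  rewrite leeD2l// leeD2r// lee_pmul2l//; apply: ge_ereal_sup => _ [v Fv <-].
  rewrite lee_fin ler_pdivlMr//; have := HS v Fv; rewrite -EFinD lee_fin; lra.
rewrite -EFinM -!EFinD lee_fin mulrCA divff ?gt_eqF//; lra.
Qed.

(** * The energy of a partition: its upper bound and its growth under refinement *)

Section energy.
Context d (X : algebraOfSetsType d) (R : realType).
Variables (mu : {content set X -> \bar R}) (g : X -> R).
Hypotheses (mu1 : mu [set: X] = 1%E) (hg : bounded_measurable_on [set: X] g).
Local Notation m A := (fine (mu A)).
Implicit Types (P Q : set X) (PP QQ : {fset set X}).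

Definition energy PP : R := \sum_(P <- PP) fa_integral mu P g ^+ 2 / m P.

Lemma bounded_measurable_on_subset P : measurable P ->
  bounded_measurable_on P g.
Proof.
move=> mP; have [s [ss sg]] := hg; exists s; split.
  by move=> n; exact: simple_on_subset (ss n).
apply/cvg_uniform_onP => e e0.
by apply: filterS ((cvg_uniform_onP _ s g).1 sg e e0) => n sn x _; exact: sn.
Qed.

Lemma partition_fine_gt0 PP P : is_partition mu PP -> P \in PP -> 0 < m P.
Proof.
move=> [mPP _ _ PP0] PPP; apply: fine_gt0; rewrite PP0//=.
by rewrite -ge0_fin_numE//; apply: content_fin_num => //; exact: mPP.
Qed.

(** A part of positive measure has a point, and disjoint sets cannot share it. *)
Lemma refines_parent_uniq PP QQ P P' Q :
  is_partition mu PP -> is_partition mu QQ ->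
  P \in PP -> P' \in PP -> Q \in QQ -> Q `<=` P -> Q `<=` P' -> P = P'.
Proof.
move=> [_ tPP _ _] [_ _ _ QQ0] PPP PPP' QQQ QP QP'; apply: tPP => //.
have [Q0|/set0P[x Qx]] := eqVneq Q set0.
  by have := QQ0 Q QQQ; rewrite Q0 measure0 ltxx.
by exists x; split; [exact: QP|exact: QP'].
Qed.

Lemma sum_refines PP QQ (h : set X -> R) :
  is_partition mu PP -> is_partition mu QQ -> refines QQ PP ->
  \sum_(Q <- QQ) h Q = \sum_(P <- PP) \sum_(Q <- QQ | `[< Q `<=` P >]) h Q.
Proof.
move=> pPP pQQ QP; rewrite (exchange_big_dep predT)//=.
apply: eq_big_seq => Q QQQ; have [P PPP QsP] := QP Q QQQ.
rewrite big_mkcond (bigD1_seq P)//= asboolT// big1_seq ?addr0// => P'.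
move=> /andP[P'P PPP']; case: asboolP => // QP'.
by rewrite (refines_parent_uniq pPP pQQ PPP' PPP QQQ QP' QsP) eqxx in P'P.
Qed.

Lemma refines_bigcup PP QQ P :
  is_partition mu PP -> is_partition mu QQ -> refines QQ PP -> P \in PP ->
  P = \bigcup_(Q in [set` [seq Q <- QQ | `[< Q `<=` P >]]]) Q.
Proof.
move=> [_ tPP _ _] [_ _ cQQ _] QP PPP.
rewrite seteqP; split=> x; last first.
  by move=> [Q] /=; rewrite mem_filter => /andP[/asboolP QsP _]; exact: QsP.
move=> Px; have [Q /= QQQ Qx] : cover [set` QQ] id x by rewrite cQQ.
exists Q => //=; rewrite mem_filter QQQ andbT; apply/asboolP.
have [P' PPP' QP'] := QP Q QQQ.
by rewrite (tPP P P')//; exists x; split => //; exact: QP'.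
Qed.

Lemma energy_le1 PP : is_partition mu PP -> (forall x, `|g x| <= 1) ->
  energy PP <= 1.
Proof.
move=> pPP g1; have [mPP tPP cPP _] := pPP.
have -> : 1 = \sum_(P <- PP) m P.
  by rewrite -(fine_content_parts mu1 (fset_uniq PP) mPP tPP (esym cPP)) mu1.
rewrite /energy big_seq [leRHS]big_seq; apply: ler_sum => P PPP.
have P0 := partition_fine_gt0 pPP PPP.
rewrite ler_pdivrMr// -expr2 -real_normK ?num_real//.
apply: lerXn2r; rewrite ?nnegrE ?(ltW P0)//.
apply: fa_integral_norm_le => //; first exact: mPP.
exact: bounded_measurable_on_subset (mPP _ _).
Qed.

Lemma energy_increment PP QQ (w : set X -> X -> R[i]) (eps : R) :
  is_partition mu PP -> is_partition mu QQ -> refines QQ PP -> 0 <= eps ->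
  (forall P x, P \in PP -> P x -> Normc.normc (w P x) <= 1) ->
  (forall P Q, P \in PP -> Q \in QQ -> Q `<=` P ->
     forall x y, Q x -> Q y -> w P x = w P y) ->
  2 * eps * \sum_(P <- PP) m P * Normc.normc
    (expectC mu P (fun x => (g x - expect mu P g)%:C%C * w P x)) <=
  energy QQ - energy PP + eps ^+ 2.
Proof.
move=> pPP pQQ QP eps0 w1 wQ; have [mPP tPP cPP _] := pPP.
have [mQQ tQQ _ _] := pQQ.
(* The total measure 1 spreads the error term over the parts, so that the claim becomes a sum of
   instances of [energy_gain_part]. *)
have -> : eps ^+ 2 = \sum_(P <- PP) eps ^+ 2 * m P.
  rewrite -mulr_sumr.
  by rewrite -(fine_content_parts mu1 (fset_uniq PP) mPP tPP (esym cPP)) mu1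
    mulr1.
rewrite /energy (sum_refines _ pPP pQQ QP) -sumrB -big_split mulr_sumr /=.
rewrite big_seq [leRHS]big_seq; apply: ler_sum => P PPP.
rewrite -[X in _ <= X - _ + _]big_filter; apply: energy_gain_part => //.
- exact/filter_uniq/fset_uniq.
- by move=> Q; rewrite mem_filter => /andP[_]; exact: mQQ.
- move=> Q Q' /=; rewrite !mem_filter => /andP[_ QQQ] /andP[_ QQQ'].
  exact: tQQ.
- exact: refines_bigcup pPP pQQ QP PPP.
- exact: partition_fine_gt0 PPP.
- by move=> Q; rewrite mem_filter => /andP[_]; exact: partition_fine_gt0.
- exact: bounded_measurable_on_subset (mPP _ _).
- by move=> x; exact: w1.
- move=> Q x y; rewrite mem_filter => /andP[/asboolP QsP QQQ].
  exact: wQ.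
Qed.

End energy.

(** * Iterating the refinement until the energy bound is exceeded *)

Theorem theorem2p1 (R : realType) (d : measure_display)
    (X : algebraOfSetsType d) (mu : {content set X -> \bar R})
    (mu1 : mu [set: X] = 1%E)
    (F : set X -> set (X -> R[i])) (hF : witness_class mu F)
    (Part : nat -> set {fset set X}) (hPart : admissible_partitions mu Part)
    (Phi : nat -> nat)
    (psi : {fset set X} -> (set X -> X -> R[i]) -> {fset set X})
    (hpsi : refinement_scheme F Part Phi psi)
    (g : X -> R) (hg : bounded_measurable_on [set: X] g)
    (g01 : forall x, 0 <= g x <= 1)
    (eps : R) (eps_gt0 : 0 < eps)
    (M0 : nat) (M0_gt0 : (0 < M0)%N)
    (PP0 : {fset set X}) (hPP0 : Part M0 PP0) :
  exists (t : nat) (PPt : {fset set X}),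
    [/\ t%:Z <= Num.ceil (eps ^- 2),
        Part (iter t Phi M0) PPt &
        eps_regular mu F g eps PPt].
Proof.
apply: contrapT => nreg.
have step M PP : (0 < M)%N -> Part M PP -> ~ eps_regular mu F g eps PP ->
    exists2 QQ, Part (Phi M) QQ &
      energy mu g PP + eps ^+ 2 < energy mu g QQ.
  move=> M0' hPP /negP; have [pPP _] := hPart _ _ hPP; have [mPP _ _ _] := pPP.
  have FP P : P \in PP -> F P !=set0 /\ forall f, F P f ->
      forall x, P x -> Normc.normc (f x) <= 1.
    move=> PPP; have [F0 F1] := hF _ (ex_intro2 _ _ PP pPP PPP).
    by split=> // f /F1[].
  (* By contraposition: if no admissible refinement gains more than [eps ^+ 2], then every choice of
     witnesses has total correlation at most [eps], and hence so has the sum of the suprema. *)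
  rewrite /eps_regular -ltNge => irreg; apply: contrapT => nQQ.
  move: irreg; apply/negP; rewrite -leNgt.
  rewrite -[leLHS]add0e.
  have -> : (\sum_(P <- PP) mu P * ereal_sup
       [set (Normc.normc
               (expectC mu P (fun x => (g x - expect mu P g)%:C%C * f x)))%:E
       | f in F P] = \sum_(P <- PP) (fine (mu P))%:E * ereal_sup
       [set (Normc.normc
               (expectC mu P (fun x => (g x - expect mu P g)%:C%C * f x)))%:E
       | f in F P])%E.
    by apply: eq_big_seq => P PPP; rewrite fineK//; apply: content_fin_num => //;
      exact: mPP.
  apply: (sum_ereal_sup_le (fun=> 0)) => //.
  - by move=> P; exact: partition_fine_gt0.
  - by move=> P f; exact: le_trans (normr_ge0 _) (normc_Re_le _).
  - by move=> P /FP[].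
  move=> w Fw; rewrite add0r leNgt; apply/negP => ew.
  have [hQQ QP wQ] := hpsi _ _ _ M0' hPP Fw; have [pQQ _] := hPart _ _ hQQ.
  apply: nQQ; exists (psi PP w) => //.
  have := energy_increment mu1 hg pPP pQQ QP (ltW eps_gt0)
    (fun P x PPP => (FP P PPP).2 _ (Fw P PPP) x) wQ.
  (* From [eps < S], the gain is at least [2 * eps * S - eps ^+ 2], which exceeds [eps ^+ 2]. *)
  by move: ew; set S := (\sum_(_ <- _) _) => ew; nra.
(* The scheme applies only to positive sizes, while [Phi] may take the value 0; a size that admits a
   partition is positive, since the empty family cannot cover a space of measure 1. *)
have Mgt0 M PP : Part M PP -> (0 < M)%N.
  move=> /hPart[[_ _ cPP _]]; case: M => //.
  rewrite leqn0 cardfs_eq0 => /eqP PPe.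
  have : mu (cover [set` PP] id) = 0%E.
    rewrite PPe (_ : cover _ _ = set0) ?measure0//.
    by rewrite -subset0 => x [].
  by rewrite cPP mu1 => /eqP; rewrite onee_eq0.
have ceil0 : 0 <= Num.ceil (eps ^- 2).
  by rewrite -(ler_int R) (le_trans _ (ceil_ge _))// invr_ge0 sqr_ge0.
(* The range goes one beyond the allowed number of steps: reaching [t.+1] uses irregularity only at
   stage [t], which is still within the bound. *)
have iter_step t : t%:Z <= Num.ceil (eps ^- 2) + 1 ->
    exists2 PP, Part (iter t Phi M0) PP & t%:R * eps ^+ 2 <= energy mu g PP.
  elim: t => [_|t IH tT].
    exists PP0 => //; rewrite mul0r /energy; apply: sumr_ge0 => P _.
    by rewrite divr_ge0 ?sqr_ge0 ?fine_ge0.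
  have tT' : t%:Z <= Num.ceil (eps ^- 2) by lia.
  have [|PP hPP tE] := IH; first by lia.
  have [|QQ hQQ QE] := step _ _ (Mgt0 _ _ hPP) hPP.
    by move=> reg; apply: nreg; exists t, PP.
  exists QQ => //; apply: le_trans (ltW QE).
  by rewrite -natr1 mulrDl mul1r lerD2r.
have /gez0_abs TE : 0 <= Num.ceil (eps ^- 2) + 1 by rewrite addr_ge0.
have [|PP hPP tE] := iter_step `|(Num.ceil (eps ^- 2) + 1)%R|%N.
  by rewrite TE.
have [pPP _] := hPart _ _ hPP.
have g1 x : `|g x| <= 1 by have /andP[gx0 gx1] := g01 x; rewrite ger0_norm.
have := le_trans tE (energy_le1 mu1 hg pPP g1).
(* At the last stage the energy is at least the ceiling times [eps ^+ 2], which is at least 1, plus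
   a further [eps ^+ 2]; this exceeds the upper bound 1. *)
rewrite pmulrn TE intrD mulrDl mul1r.
have : 1 <= (Num.ceil (eps ^- 2))%:~R * eps ^+ 2.
  by rewrite -ler_pdivrMr ?exprn_gt0// div1r ceil_ge.
have : 0 < eps ^+ 2 by rewrite exprn_gt0.
lra.
Qed.
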